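(* For every type $X$, $\mathsf{E\text{-}PA}^\omega+\mathsf{AC}_{\mathbb{N},X}+\mathsf{Spec}_{X^\dagger}\vdash\mathsf{sSpec}_X$, where for a type $Z$ $$\mathsf{Spec}_Z:\ \forall\varphi^{Z^{\mathbb{N}}\to\mathbb{N}}\forall\alpha^{Z^{\mathbb{N}}}\exists n\,\big(\varphi(\widehat{\overline{\alpha}n})<n\big),\qquad \mathsf{sSpec}_Z:\ \forall\varphi^{Z^{\mathbb{N}}\to\mathbb{N}}\forall\alpha^{Z^{\mathbb{N}}}\exists n\,\big(\hat\varphi([\alpha]^{\varphi}_{n})\in\mathrm{dom}([\alpha]^{\varphi}_{n})\big).$$
   Context: $\mathsf{E\text{-}PA}^\omega$ is classical extensional Peano arithmetic in all finite types (full induction, $\lambda$-abstraction, primitive recursors at all types). $\mathsf{AC}_{\mathbb{N},X}$ is the countable choice schema $\forall n^{\mathbb{N}}\exists x^X A(n,x)\to\exists f^{\mathbb{N}\to X}\forall n\,A(n,f(n))$ for arbitrary formulas $A$. $Z^{\mathbb{N}}$ is the type $\mathbb{N}\to Z$. For $\alpha\colon Z^{\mathbb{N}}$, $\overline{\alpha}n=\langle\alpha(0),\dots,\alpha(n-1)\rangle$; for a finite sequence $s$, $\hat s\colon Z^{\mathbb{N}}$ extends $s$ by the canonical element $\mathbf{0}_Z$. $X^\dagger$ is the type of finite partial functions from $\mathbb{N}$ to $X$ with decidable finite domain $\mathrm{dom}(u)$ (canonical element $\mathbf{0}_{X^\dagger}=\emptyset$, the nowhere-defined function); $\hat u\colon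 X^{\mathbb{N}}$ agrees with $u$ on $\mathrm{dom}(u)$ and is $\mathbf{0}_X$ elsewhere; $\hat\varphi(u):=\varphi(\hat u)$. $u\oplus(n,x)$ equals $u$ if $n\in\mathrm{dom}(u)$ and otherwise is $u$ extended with value $x$ at $n$. The $\varphi$-thread of $\alpha\colon X^{\mathbb{N}}$: $[\alpha]^{\varphi}_{0}=\emptyset$, $[\alpha]^{\varphi}_{i+1}=[\alpha]^{\varphi}_{i}\oplus(m_i,\alpha(m_i))$ with $m_i:=\hat\varphi([\alpha]^{\varphi}_{i})$. *)

(* Defs.v *)
From Stdlib Require Import List.
Import ListNotations.

Set Implicit Arguments.
Unset Strict Implicit.

(** * Finite types

    [Seq Z] is the type of finite sequences over [Z] and [Fpf X] is the type
    X† of finite partial functions from the natural numbers to [X].  The types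
    are closed under both constructors, so that "for every type X" includes
    types built from sequences and finite partial functions. *)

Inductive ty : Type :=
| N : ty
| Arr : ty -> ty -> ty
| Prod : ty -> ty -> ty
| Seq : ty -> ty
| Fpf : ty -> ty.

Declare Scope fin_scope.
Delimit Scope fin_scope with fin.
Local Open Scope fin_scope.

Notation "s ⇒ t" := (Arr s t) (at level 55, right associativity) : fin_scope.
Notation "X †" := (Fpf X) (at level 8, format "X †") : fin_scope.

(** * Intrinsically typed de Bruijn terms *)

Definition ctx := list ty.

Inductive var : ctx -> ty -> Type :=
| VZ G t : var (t :: G) t
| VS G s t : var G t -> var (s :: G) t.
Arguments VZ {G t}.
Arguments VS {G s t} _.

Inductive cst : ty -> Type :=
| CZero : cst N
| CSucc : cst (N ⇒ N)
| CRec t : cst (t ⇒ (N ⇒ t ⇒ t) ⇒ N ⇒ t)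
| CPair s t : cst (s ⇒ t ⇒ Prod s t)
| CFst s t : cst (Prod s t ⇒ s)
| CSnd s t : cst (Prod s t ⇒ t)
| CNil Z : cst (Seq Z)
| CCons Z : cst (Z ⇒ Seq Z ⇒ Seq Z)
| CSeqRec Z t : cst (t ⇒ (Z ⇒ Seq Z ⇒ t ⇒ t) ⇒ Seq Z ⇒ t)
| CEmp X : cst (X†)                        (* the nowhere-defined function *)
| CExt X : cst (X† ⇒ N ⇒ X ⇒ X†)           (* u ⊕ (n, x) *)
| CDom X : cst (X† ⇒ N ⇒ N)                (* characteristic function of dom u *)
| CHat X : cst (X† ⇒ N ⇒ X)                (* û *)
| CBnd X : cst (X† ⇒ N).                   (* least strict upper bound of dom u *)

Inductive tm (G : ctx) : ty -> Type :=
| Var t : var G t -> tm G t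
| Cst t : cst t -> tm G t
| Lam s t : tm (s :: G) t -> tm G (s ⇒ t)
| App s t : tm G (s ⇒ t) -> tm G s -> tm G t.
Arguments Var {G t} _.
Arguments Cst {G t} _.
Arguments Lam {G} s {t} _.
Arguments App {G s t} _ _.

Notation "f ⋅ a" := (App f a) (at level 40, left associativity) : fin_scope.

Inductive fm (G : ctx) : Type :=
| Bot : fm G
| Eq t : tm G t -> tm G t -> fm G
| And : fm G -> fm G -> fm G
| Or : fm G -> fm G -> fm G
| Imp : fm G -> fm G -> fm G
| All t : fm (t :: G) -> fm G
| Ex t : fm (t :: G) -> fm G.
Arguments Bot {G}.
Arguments All {G} t _.
Arguments Ex {G} t _.

Notation "a ≡ b" := (Eq a b) (at level 70, no associativity) : fin_scope.
Notation "A ⋀ B" := (And A B) (at level 76, right associativity) : fin_scope.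
Notation "A ⋁ B" := (Or A B) (at level 77, right associativity) : fin_scope.
Notation "A ⊃ B" := (Imp A B) (at level 79, right associativity) : fin_scope.
Notation "∀[ t ] A" := (All t A) (at level 80, A at level 80, right associativity) : fin_scope.
Notation "∃[ t ] A" := (Ex t A) (at level 80, A at level 80, right associativity) : fin_scope.
Notation Neg A := (Imp A Bot).

(** * Renaming and substitution *)

Definition ren (G D : ctx) := forall t, var G t -> var D t.
Definition sub (G D : ctx) := forall t, var G t -> tm D t.

Definition scons (P : ty -> Type) G s (a : P s) (f : forall t, var G t -> P t) :
  forall t, var (s :: G) t -> P t :=
  fun t v =>
    match v in var G' t' return
      match G' with
      | nil => unit
      | s' :: G0 => P s' -> (forall t, var G0 t -> P t) -> P t'
      end
    with
    | VZ => fun a _ => a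
    | VS w => fun _ f => f _ w
    end a f.

Definition upr G D s (r : ren G D) : ren (s :: G) (s :: D) :=
  scons (P := var (s :: D)) VZ (fun t v => VS (r t v)).

Fixpoint ren_tm G t (a : tm G t) D (r : ren G D) : tm D t :=
  match a with
  | Var v => Var (r _ v)
  | Cst c => Cst c
  | Lam s b => Lam s (ren_tm b (upr r))
  | App f b => ren_tm f r ⋅ ren_tm b r
  end.

Fixpoint ren_fm G (A : fm G) D (r : ren G D) : fm D :=
  match A with
  | Bot => Bot
  | a ≡ b => ren_tm a r ≡ ren_tm b r
  | A ⋀ B => ren_fm A r ⋀ ren_fm B r
  | A ⋁ B => ren_fm A r ⋁ ren_fm B r
  | A ⊃ B => ren_fm A r ⊃ ren_fm B r
  | All t A => All t (ren_fm A (upr r))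
  | Ex t A => Ex t (ren_fm A (upr r))
  end.

Definition wk_tm G s t (a : tm G t) : tm (s :: G) t := ren_tm a (fun _ v => VS v).
Definition wk_fm G s (A : fm G) : fm (s :: G) := ren_fm A (fun _ v => VS v).

Definition ups G D s (r : sub G D) : sub (s :: G) (s :: D) :=
  scons (P := tm (s :: D)) (Var VZ) (fun t v => wk_tm s (r t v)).

Fixpoint sub_tm G t (a : tm G t) D (r : sub G D) : tm D t :=
  match a with
  | Var v => r _ v
  | Cst c => Cst c
  | Lam s b => Lam s (sub_tm b (ups r))
  | App f b => sub_tm f r ⋅ sub_tm b r
  end.

Fixpoint sub_fm G (A : fm G) D (r : sub G D) : fm D :=
  match A with
  | Bot => Bot
  | a ≡ b => sub_tm a r ≡ sub_tm b r
  | A ⋀ B => sub_fm A r ⋀ sub_fm B r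
  | A ⋁ B => sub_fm A r ⋁ sub_fm B r
  | A ⊃ B => sub_fm A r ⊃ sub_fm B r
  | All t A => All t (sub_fm A (ups r))
  | Ex t A => Ex t (sub_fm A (ups r))
  end.

Definition inst G s (a : tm G s) : sub (s :: G) G :=
  scons (P := tm G) a (fun _ v => Var v).

(** * Abbreviations in the object language *)

Notation v0 := (Var VZ).
Notation v1 := (Var (VS VZ)).
Notation v2 := (Var (VS (VS VZ))).
Notation v3 := (Var (VS (VS (VS VZ)))).

Notation Zero := (Cst CZero).
Notation Suc a := (Cst CSucc ⋅ a).
Notation Rec := (Cst (CRec _)).
Notation SeqRec := (Cst (CSeqRec _ _)).
Notation Emp := (Cst (CEmp _)).
Notation Ext u n x := (Cst (CExt _) ⋅ u ⋅ n ⋅ x).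
Notation DomF u n := (Cst (CDom _) ⋅ u ⋅ n).
Notation Hat u := (Cst (CHat _) ⋅ u).
Notation Bnd u := (Cst (CBnd _) ⋅ u).

(** The canonical element [0_Z] of each type. *)
Fixpoint zero G (Z : ty) : tm G Z :=
  match Z with
  | N => Zero
  | s ⇒ t => Lam s (zero (s :: G) t)
  | Prod s t => Cst (CPair s t) ⋅ zero G s ⋅ zero G t
  | Seq _ => Cst (CNil _)
  | X† => Emp
  end.

Definition plus {G} : tm G (N ⇒ N ⇒ N) :=
  Lam N (Lam N (Rec ⋅ v1 ⋅ Lam N (Lam N (Suc v0)) ⋅ v0)).

Definition Lt G (a b : tm G N) : fm G :=
  ∃[N] Suc (plus ⋅ wk_tm N a ⋅ v0) ≡ wk_tm N b.

(** [n ∈ dom u] *)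
Definition InDom G X (u : tm G (X†)) (n : tm G N) : fm G :=
  DomF u n ≡ Suc Zero.

(** [s ↦ ŝ], by recursion on [s]: if [t = z :: s] then [t̂ 0 = z] and
    [t̂ (k+1) = ŝ k]; for the empty sequence [ŝ k = 0_Z]. *)
Definition hat_seq G Z : tm G (Seq Z ⇒ N ⇒ Z) :=
  Lam (Seq Z)
    (SeqRec
       ⋅ Lam N (zero _ Z)
       ⋅ Lam Z (Lam (Seq Z) (Lam (N ⇒ Z) (Lam N
           (Rec ⋅ v3 ⋅ Lam N (Lam Z (v3 ⋅ v1)) ⋅ v0))))
       ⋅ v0).
Arguments hat_seq {G Z}.

(** [α, n ↦ ⟨α 0, ..., α (n-1)⟩], by recursion on [n] along
    [⟨α 0, ..., α n⟩ = α 0 :: ⟨α' 0, ..., α' (n-1)⟩] with [α' k = α (k+1)]. *)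
Definition initseg G Z : tm G ((N ⇒ Z) ⇒ N ⇒ Seq Z) :=
  Lam (N ⇒ Z) (Lam N
    (Rec
       ⋅ Lam (N ⇒ Z) (Cst (CNil Z))
       ⋅ Lam N (Lam ((N ⇒ Z) ⇒ Seq Z) (Lam (N ⇒ Z)
           (Cst (CCons Z) ⋅ (v0 ⋅ Zero) ⋅ (v1 ⋅ Lam N (v1 ⋅ Suc v0)))))
       ⋅ v0 ⋅ v1)).
Arguments initseg {G Z}.

(** [φ, u ↦ φ û] *)
Definition phihat G X : tm G (((N ⇒ X) ⇒ N) ⇒ X† ⇒ N) :=
  Lam ((N ⇒ X) ⇒ N) (Lam (X†) (v1 ⋅ Hat v0)).
Arguments phihat {G X}.

(** [φ, α, i ↦ [α]^φ_i] *)
Definition thread G X : tm G (((N ⇒ X) ⇒ N) ⇒ (N ⇒ X) ⇒ N ⇒ X†) :=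
  Lam ((N ⇒ X) ⇒ N) (Lam (N ⇒ X)
    (Rec
       ⋅ Emp
       ⋅ Lam N (Lam (X†) (Ext v0 (phihat ⋅ v3 ⋅ v0) (v2 ⋅ (phihat ⋅ v3 ⋅ v0)))))).
Arguments thread {G X}.

(** * Theories and classical provability

    A theory assigns to each context the formulas over it that are axioms;
    schemas are thereby allowed to have parameters. *)

Definition theory := forall G : ctx, fm G -> Prop.

Definition union (T U : theory) : theory := fun G A => T G A \/ U G A.
Notation "T ∪ U" := (union T U) (at level 50, left associativity) : fin_scope.

Inductive prv (T : theory) : forall G : ctx, list (fm G) -> fm G -> Prop :=
| PAx G (H : list (fm G)) A : T G A -> prv T H A
| PHyp G (H : list (fm G)) A : In A H -> prv T H A
| PBotE G (H : list (fm G)) A : prv T H Bot -> prv T H A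
| PDne G (H : list (fm G)) A : prv T H (Neg (Neg A)) -> prv T H A
| PAndI G (H : list (fm G)) A B : prv T H A -> prv T H B -> prv T H (A ⋀ B)
| PAndEl G (H : list (fm G)) A B : prv T H (A ⋀ B) -> prv T H A
| PAndEr G (H : list (fm G)) A B : prv T H (A ⋀ B) -> prv T H B
| POrIl G (H : list (fm G)) A B : prv T H A -> prv T H (A ⋁ B)
| POrIr G (H : list (fm G)) A B : prv T H B -> prv T H (A ⋁ B)
| POrE G (H : list (fm G)) A B C :
    prv T H (A ⋁ B) -> prv T (A :: H) C -> prv T (B :: H) C -> prv T H C
| PImpI G (H : list (fm G)) A B : prv T (A :: H) B -> prv T H (A ⊃ B)
| PImpE G (H : list (fm G)) A B : prv T H (A ⊃ B) -> prv T H A -> prv T H B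
| PAllI G (H : list (fm G)) t (A : fm (t :: G)) :
    prv T (map (@wk_fm G t) H) A -> prv T H (∀[t] A)
| PAllE G (H : list (fm G)) t (A : fm (t :: G)) (a : tm G t) :
    prv T H (∀[t] A) -> prv T H (sub_fm A (inst a))
| PExI G (H : list (fm G)) t (A : fm (t :: G)) (a : tm G t) :
    prv T H (sub_fm A (inst a)) -> prv T H (∃[t] A)
| PExE G (H : list (fm G)) t (A : fm (t :: G)) (C : fm G) :
    prv T H (∃[t] A) -> prv T (A :: map (@wk_fm G t) H) (wk_fm t C) -> prv T H C
| PEqRefl G (H : list (fm G)) t (a : tm G t) : prv T H (a ≡ a)
| PEqSubst G (H : list (fm G)) t (A : fm (t :: G)) (a b : tm G t) :
    prv T H (a ≡ b) -> prv T H (sub_fm A (inst a)) -> prv T H (sub_fm A (inst b))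
| PBeta G (H : list (fm G)) s t (b : tm (s :: G) t) (a : tm G s) :
    prv T H (Lam s b ⋅ a ≡ sub_tm b (inst a)).

Definition provable (T : theory) (A : fm []) : Prop := prv T [] A.

(** * Classical extensional Peano arithmetic in all finite types

    Logic, equality and β-conversion are part of [prv].  The axioms for X†
    say that its elements are given by a decidable domain with a least strict
    upper bound [Bnd] and by their values, that [û] is canonical outside
    [dom u], and that [∅] and [⊕] act as described.  [Bnd] expresses that
    domains are finite. *)

Inductive EPAω : theory :=
| succ_neq0 G (a : tm G N) : EPAω (Neg (Suc a ≡ Zero))
| succ_inj G (a b : tm G N) : EPAω (Suc a ≡ Suc b ⊃ a ≡ b)
| induction G (A : fm (N :: G)) :
    EPAω (sub_fm A (inst Zero)
       ⊃ (∀[N] (A ⊃ sub_fm A (scons (P := tm (N :: G)) (Suc v0) (fun _ v => Var (VS v)))))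
       ⊃ ∀[N] A)
| rec_zero G t (z : tm G t) (f : tm G (N ⇒ t ⇒ t)) :
    EPAω (Rec ⋅ z ⋅ f ⋅ Zero ≡ z)
| rec_succ G t (z : tm G t) (f : tm G (N ⇒ t ⇒ t)) (a : tm G N) :
    EPAω (Rec ⋅ z ⋅ f ⋅ Suc a ≡ f ⋅ a ⋅ (Rec ⋅ z ⋅ f ⋅ a))
| fun_ext G s t (f g : tm G (s ⇒ t)) :
    EPAω ((∀[s] wk_tm s f ⋅ v0 ≡ wk_tm s g ⋅ v0) ⊃ f ≡ g)
| fst_pair G s t (a : tm G s) (b : tm G t) :
    EPAω (Cst (CFst s t) ⋅ (Cst (CPair s t) ⋅ a ⋅ b) ≡ a)
| snd_pair G s t (a : tm G s) (b : tm G t) :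
    EPAω (Cst (CSnd s t) ⋅ (Cst (CPair s t) ⋅ a ⋅ b) ≡ b)
| pair_eta G s t (p : tm G (Prod s t)) :
    EPAω (Cst (CPair s t) ⋅ (Cst (CFst s t) ⋅ p) ⋅ (Cst (CSnd s t) ⋅ p) ≡ p)
| seqrec_nil G Z t (z : tm G t) (f : tm G (Z ⇒ Seq Z ⇒ t ⇒ t)) :
    EPAω (SeqRec ⋅ z ⋅ f ⋅ Cst (CNil Z) ≡ z)
| seqrec_cons G Z t (z : tm G t) (f : tm G (Z ⇒ Seq Z ⇒ t ⇒ t))
    (a : tm G Z) (s : tm G (Seq Z)) :
    EPAω (SeqRec ⋅ z ⋅ f ⋅ (Cst (CCons Z) ⋅ a ⋅ s) ≡ f ⋅ a ⋅ s ⋅ (SeqRec ⋅ z ⋅ f ⋅ s))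
| seq_induction G Z (A : fm (Seq Z :: G)) :
    EPAω (sub_fm A (inst (Cst (CNil Z)))
       ⊃ (∀[Seq Z] (A ⊃ ∀[Z] sub_fm A
            (scons (P := tm (Z :: Seq Z :: G)) (Cst (CCons Z) ⋅ v0 ⋅ v1)
               (fun _ v => Var (VS (VS v))))))
       ⊃ ∀[Seq Z] A)
| dom_dec G X (u : tm G (X†)) (n : tm G N) :
    EPAω (DomF u n ≡ Zero ⋁ DomF u n ≡ Suc Zero)
| dom_bound G X (u : tm G (X†)) (n : tm G N) :
    EPAω (InDom u n ⊃ Lt n (Bnd u))
| dom_bound_least G X (u : tm G (X†)) (k : tm G N) :
    EPAω ((∀[N] (InDom (wk_tm N u) v0 ⊃ Lt v0 (wk_tm N k))) ⊃ Neg (Lt k (Bnd u)))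
| hat_notin G X (u : tm G (X†)) (n : tm G N) :
    EPAω (Neg (InDom u n) ⊃ Hat u ⋅ n ≡ zero G X)
| fpf_ext G X (u v : tm G (X†)) :
    EPAω (Cst (CDom X) ⋅ u ≡ Cst (CDom X) ⋅ v ⊃ Hat u ≡ Hat v ⊃ u ≡ v)
| dom_emp G X (n : tm G N) :
    EPAω (Neg (InDom (Cst (CEmp X)) n))
| ext_in G X (u : tm G (X†)) (n : tm G N) (x : tm G X) :
    EPAω (InDom u n ⊃ Ext u n x ≡ u)
| dom_ext_same G X (u : tm G (X†)) (n : tm G N) (x : tm G X) :
    EPAω (InDom (Ext u n x) n)
| dom_ext_other G X (u : tm G (X†)) (n m : tm G N) (x : tm G X) :
    EPAω (Neg (m ≡ n) ⊃ DomF (Ext u n x) m ≡ DomF u m)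
| hat_ext_same G X (u : tm G (X†)) (n : tm G N) (x : tm G X) :
    EPAω (Neg (InDom u n) ⊃ Hat (Ext u n x) ⋅ n ≡ x)
| hat_ext_other G X (u : tm G (X†)) (n m : tm G N) (x : tm G X) :
    EPAω (Neg (m ≡ n) ⊃ Hat (Ext u n x) ⋅ m ≡ Hat u ⋅ m).

(** * Countable choice and the two forms of Spector's condition *)

(** In [A], the variable [v1] is the number and [v0] the chosen object; in the
    conclusion the context is extended by [f] and then by [n]. *)
Inductive AC_N (X : ty) : theory :=
| choice G (A : fm (X :: N :: G)) :
    AC_N X ((∀[N] ∃[X] A)
       ⊃ ∃[N ⇒ X] ∀[N] sub_fm A
           (scons (P := tm (N :: (N ⇒ X) :: G)) (v1 ⋅ v0)
             (scons (P := tm (N :: (N ⇒ X) :: G)) v0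
               (fun _ v => Var (VS (VS v)))))).

Definition Spec G Z : fm G :=
  ∀[(N ⇒ Z) ⇒ N] ∀[N ⇒ Z] ∃[N]
    Lt (v2 ⋅ (hat_seq ⋅ (initseg ⋅ v1 ⋅ v0))) v0.

Definition sSpec G X : fm G :=
  ∀[(N ⇒ X) ⇒ N] ∀[N ⇒ X] ∃[N]
    InDom (thread ⋅ v2 ⋅ v1 ⋅ v0) (phihat ⋅ v2 ⋅ (thread ⋅ v2 ⋅ v1 ⋅ v0)).

Inductive SpecAx (Z : ty) : theory :=
| spec_ax G : SpecAx Z (Spec G Z).

(* Main.v *)
(** Write [u_i] for the thread [[α]^φ_i] and [m_i = φ û_i], so that [m_i ∈ dom u_{i+1}].
    Classically, every [k] either lies in no [dom u_i] or enters at some stage [j], i.e.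
    [k ∈ dom u_{j+1}] and [k ∉ dom u_j].  Since [N] is a definable retract of [X], choice into [X]
    yields a function [h : N ⇒ N] picking such a [j] for each [k] that enters.

    Apply [Spec] at type [X†] to the sequence [β i = u_{i+1}] and to the functional
    [γ ↦ h (φ (λk. (γ (h k))^ k))], where [^] is the hat on finite partial functions.  For [γ] the
    padding of [⟨β 0, ..., β (n-1)⟩] by [∅], the function [λk. (γ (h k))^ k] is [û_n], since [u_n]
    consists of the entering [k] with [h k < n].  So [Spec] provides an [n] with [h m_n < n], and as
    [m_n ∈ dom u_{n+1}] does enter, it is already in [dom u_n]. *)

From Stdlib Require Import List Setoid Morphisms.
Require Import Defs.
Import ListNotations.

Local Open Scope fin_scope.
Set Implicit Arguments.
Unset Strict Implicit.

(** * Substitution *)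

(** The inner match abstracts the index [s :: G] and passes the predicate as an argument, so that
    case analysis on a typed variable needs no axiom on equality of contexts. *)
Lemma var_cons_ind s G (P : forall t, var (s :: G) t -> Prop) :
  P s VZ -> (forall t v, P t (VS v)) -> forall t v, P t v.
Proof.
  intros hz hs t v.
  refine (match v in var G' t' return
    match G' return var G' t' -> Prop with
    | nil => fun _ => True
    | s' :: G0 => fun w => forall Q : forall t, var (s' :: G0) t -> Prop,
        Q s' VZ -> (forall t v, Q t (VS v)) -> Q t' w
    end v with
    | VZ => fun Q qz _ => qz
    | VS w => fun Q _ qs => qs _ w
    end P hz hs).
Qed.

(** Renamings are functions and functional extensionality is not assumed, so the substitution
    calculus compares them pointwise; under a [Lam], [var_cons_ind] reduces the comparison to the
    new variable and the old ones. *)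
Lemma ren_tm_ext G t (a : tm G t) : forall D (r r' : ren G D),
  (forall t v, r t v = r' t v) -> ren_tm a r = ren_tm a r'.
Proof.
  induction a as [G t v|G t c|G s t b IH|G s t f IHf b IHb]; intros D r r' e; cbn.
  - now rewrite e.
  - reflexivity.
  - f_equal. apply IH. apply var_cons_ind; [reflexivity|].
    intros; cbn; now rewrite e.
  - now rewrite (IHf _ _ _ e), (IHb _ _ _ e).
Qed.

Lemma sub_tm_ext G t (a : tm G t) : forall D (r r' : sub G D),
  (forall t v, r t v = r' t v) -> sub_tm a r = sub_tm a r'.
Proof.
  induction a as [G t v|G t c|G s t b IH|G s t f IHf b IHb]; intros D r r' e; cbn.
  - apply e.
  - reflexivity.
  - f_equal. apply IH. apply var_cons_ind; [reflexivity|].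
    intros; cbn; now rewrite e.
  - now rewrite (IHf _ _ _ e), (IHb _ _ _ e).
Qed.

Lemma ren_ren_tm G t (a : tm G t) : forall D E (r : ren G D) (r' : ren D E),
  ren_tm (ren_tm a r) r' = ren_tm a (fun t v => r' t (r t v)).
Proof.
  induction a as [G t v|G t c|G s t b IH|G s t f IHf b IHb]; intros D E r r'; cbn;
    [reflexivity|reflexivity| |now rewrite IHf, IHb].
  f_equal. rewrite IH. apply ren_tm_ext. now apply var_cons_ind.
Qed.

Lemma sub_ren_tm G t (a : tm G t) : forall D E (r : ren G D) (r' : sub D E),
  sub_tm (ren_tm a r) r' = sub_tm a (fun t v => r' t (r t v)).
Proof.
  induction a as [G t v|G t c|G s t b IH|G s t f IHf b IHb]; intros D E r r'; cbn;
    [reflexivity|reflexivity| |now rewrite IHf, IHb].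
  f_equal. rewrite IH. apply sub_tm_ext. now apply var_cons_ind.
Qed.

Lemma ren_sub_tm G t (a : tm G t) : forall D E (r : sub G D) (r' : ren D E),
  ren_tm (sub_tm a r) r' = sub_tm a (fun t v => ren_tm (r t v) r').
Proof.
  induction a as [G t v|G t c|G s t b IH|G s t f IHf b IHb]; intros D E r r'; cbn;
    [reflexivity|reflexivity| |now rewrite IHf, IHb].
  f_equal. rewrite IH. apply sub_tm_ext. apply var_cons_ind; [reflexivity|].
  intros; cbn; unfold wk_tm; now rewrite !ren_ren_tm.
Qed.

Lemma sub_tm_var G t (a : tm G t) D (r : ren G D) :
  sub_tm a (fun t v => Var (r t v)) = ren_tm a r.
Proof.
  revert D r.
  induction a as [G t v|G t c|G s t b IH|G s t f IHf b IHb]; intros D r; cbn;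
    [reflexivity|reflexivity| |now rewrite IHf, IHb].
  f_equal. rewrite <- IH. apply sub_tm_ext. now apply var_cons_ind.
Qed.

Lemma ren_tm_id G t (a : tm G t) : ren_tm a (fun _ v => v) = a.
Proof.
  induction a as [G t v|G t c|G s t b IH|G s t f IHf b IHb]; cbn;
    [reflexivity|reflexivity| |now rewrite IHf, IHb].
  f_equal. rewrite <- IH at 2. apply ren_tm_ext. now apply var_cons_ind.
Qed.

Lemma sub_tm_id G t (a : tm G t) : sub_tm a (fun _ v => Var v) = a.
Proof. rewrite (sub_tm_var a (fun _ v => v)). apply ren_tm_id. Qed.

Lemma sub_wk_scons G D s t (a : tm G t) (b : tm D s) (r : sub G D) :
  sub_tm (wk_tm s a) (scons (P := tm D) b r) = sub_tm a r.
Proof. unfold wk_tm. now rewrite sub_ren_tm. Qed.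

Lemma sub_wk_inst G s t (a : tm G t) (b : tm G s) : sub_tm (wk_tm s a) (inst b) = a.
Proof. unfold inst. now rewrite sub_wk_scons, sub_tm_id. Qed.

Lemma sub_wk_ups G D s t (a : tm G t) (r : sub G D) :
  sub_tm (wk_tm s a) (ups r) = wk_tm s (sub_tm a r).
Proof. unfold wk_tm. now rewrite sub_ren_tm, ren_sub_tm. Qed.

Lemma ren_wk_upr G D s t (a : tm G t) (r : ren G D) :
  ren_tm (wk_tm s a) (upr r) = wk_tm s (ren_tm a r).
Proof. unfold wk_tm. now rewrite !ren_ren_tm. Qed.

Lemma ren_tm_VS G s t (a : tm G t) : ren_tm a (fun _ v => VS v) = wk_tm s a.
Proof. reflexivity. Qed.

Lemma sub_tm_VS G s t (a : tm G t) : sub_tm a (fun _ v => Var (VS v)) = wk_tm s a.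
Proof. apply (sub_tm_var a (fun _ v => VS v)). Qed.

Lemma sub_tm_VS2 G s s' t (a : tm G t) :
  sub_tm a (fun _ v => Var (VS (VS v))) = wk_tm s' (wk_tm s a).
Proof.
  unfold wk_tm. rewrite ren_ren_tm. apply (sub_tm_var a (fun _ v => VS (VS v))).
Qed.

Lemma sub_zero Z : forall G D (r : sub G D), sub_tm (zero G Z) r = zero D Z.
Proof. induction Z; intros; cbn; congruence. Qed.
Lemma ren_zero Z : forall G D (r : ren G D), ren_tm (zero G Z) r = zero D Z.
Proof. induction Z; intros; cbn; congruence. Qed.
Lemma sub_hat_seq Z G D (r : sub G D) : sub_tm (@hat_seq G Z) r = hat_seq.
Proof. unfold hat_seq; cbn. now rewrite sub_zero. Qed.
Lemma ren_hat_seq Z G D (r : ren G D) : ren_tm (@hat_seq G Z) r = hat_seq.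
Proof. unfold hat_seq; cbn. now rewrite ren_zero. Qed.

Lemma sub_InDom G D X (u : tm G (X†)) n (r : sub G D) :
  sub_fm (InDom u n) r = InDom (sub_tm u r) (sub_tm n r).
Proof. reflexivity. Qed.
Lemma ren_InDom G D X (u : tm G (X†)) n (r : ren G D) :
  ren_fm (InDom u n) r = InDom (ren_tm u r) (ren_tm n r).
Proof. reflexivity. Qed.

(** [N] is a retract of every type, so that choice into [X] gives choice into [N]. *)
Fixpoint enc G (X : ty) : tm G (N ⇒ X) :=
  match X with
  | N => Lam N v0
  | s ⇒ t => Lam N (Lam s (enc _ t ⋅ v1))
  | Prod s t => Lam N (Cst (CPair s t) ⋅ (enc _ s ⋅ v0) ⋅ zero _ t)
  | Seq Z => Lam N (Cst (CCons Z) ⋅ (enc _ Z ⋅ v0) ⋅ Cst (CNil Z))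
  | X† => Lam N (Ext Emp Zero (enc _ X ⋅ v0))
  end.

Fixpoint dec G (X : ty) : tm G (X ⇒ N) :=
  match X with
  | N => Lam N v0
  | s ⇒ t => Lam (s ⇒ t) (dec _ t ⋅ (v0 ⋅ zero _ s))
  | Prod s t => Lam (Prod s t) (dec _ s ⋅ (Cst (CFst s t) ⋅ v0))
  | Seq Z => Lam (Seq Z) (dec _ Z ⋅ (hat_seq ⋅ v0 ⋅ Zero))
  | X† => Lam (X†) (dec _ X ⋅ (Hat v0 ⋅ Zero))
  end.

Lemma sub_enc X : forall G D (r : sub G D), sub_tm (enc G X) r = enc D X.
Proof. induction X; intros; cbn; rewrite ?sub_zero; congruence. Qed.
Lemma sub_dec X : forall G D (r : sub G D), sub_tm (dec G X) r = dec D X.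
Proof.
  induction X; intros; cbn [dec sub_tm]; rewrite ?IHX, ?IHX1, ?IHX2, ?sub_zero, ?sub_hat_seq;
    reflexivity.
Qed.
Lemma ren_dec X : forall G D (r : ren G D), ren_tm (dec G X) r = dec D X.
Proof.
  induction X; intros; cbn [dec ren_tm]; rewrite ?IHX, ?IHX1, ?IHX2, ?ren_zero, ?ren_hat_seq;
    reflexivity.
Qed.

#[export] Hint Rewrite sub_wk_inst sub_wk_scons sub_wk_ups ren_wk_upr ren_tm_VS sub_tm_VS
  sub_tm_VS2 sub_zero ren_zero sub_hat_seq ren_hat_seq sub_enc sub_dec ren_dec sub_InDom ren_InDom : subst.

(** These make [cbn] unfold substitutions only when applied to a constructor, so that
    weakenings of term metavariables stay folded for the rewrite rules of [subst]. *)
Arguments scons P G s a f t !v /.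
Arguments inst G s a t !v /.
Arguments ups G D s r t !v /.
Arguments upr G D s r t !v /.
Arguments wk_tm G s t !a /.

Ltac simp_subst :=
  repeat (progress (cbn [map sub_fm ren_fm wk_fm sub_tm ren_tm scons inst ups upr wk_tm];
    autorewrite with subst)).

Ltac simp_subst_in h :=
  repeat (progress (cbn [map sub_fm ren_fm wk_fm sub_tm ren_tm scons inst ups upr wk_tm] in h;
    autorewrite with subst in h)).

(** * Natural deduction with equality *)

(** Everything is proved for an arbitrary extension of [EPAω], with instance search supplying the
    inclusion, so it applies directly in the theory with choice and Spector's condition. *)
Class arithmetic (T : theory) : Prop := arithmetic_ax : forall G (A : fm G), EPAω A -> T G A.

(** Provable equality as a relation, for setoid rewriting. *)
Definition eqp T G (H : list (fm G)) t (a b : tm G t) : Prop := prv T H (a ≡ b).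

(** [InDom] is itself an equation, so membership goals can be rewritten by provable equalities as
    well. *)
Ltac to_eqp :=
  match goal with
  | |- prv ?T ?H (?a ≡ ?b) => change (eqp T H a b)
  | |- prv ?T ?H (InDom ?u ?n) => change (eqp T H (DomF u n) (Suc Zero))
  end.

Ltac hyp := apply PHyp; repeat (first [left; reflexivity | right]).

Section Logic.
Context {T : theory}.

Lemma prv_weaken G (H : list (fm G)) A : prv T H A -> forall H', incl H H' -> prv T H' A.
Proof.
  induction 1; intros H' i.
  all: try solve [econstructor; eauto].
  - eapply POrE; [now apply IHprv1|apply IHprv2|apply IHprv3];
      (apply incl_cons; [left; reflexivity|now apply incl_tl]).
  - apply PImpI, IHprv, incl_cons; [left; reflexivity|now apply incl_tl].
  - apply PAllI, IHprv. now apply incl_map.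
  - eapply PExE; [now apply IHprv1|].
    apply IHprv2, incl_cons; [left; reflexivity|now apply incl_tl, incl_map].
Qed.

Lemma prv_head G (H : list (fm G)) A : prv T (A :: H) A.
Proof. apply PHyp. now left. Qed.

Lemma prv_cons G (H : list (fm G)) A B : prv T H A -> prv T (B :: H) A.
Proof. intros p. apply (prv_weaken p). now apply incl_tl. Qed.

Lemma prv_cut G (H : list (fm G)) A B : prv T H A -> prv T (A :: H) B -> prv T H B.
Proof. intros p q. exact (PImpE (PImpI q) p). Qed.

Lemma prv_absurd G (H : list (fm G)) A B : prv T H A -> prv T H (Neg A) -> prv T H B.
Proof. intros p q. exact (PBotE _ (PImpE q p)). Qed.

(** Excluded middle comes from [PDne]: under the assumption [Neg C], the first branch refutes [A],
    and the second branch then yields [C]. *)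
Lemma prv_cases G (H : list (fm G)) A C :
  prv T (A :: H) C -> prv T (Neg A :: H) C -> prv T H C.
Proof.
  intros p q. apply PDne, PImpI.
  assert (n : prv T (Neg C :: H) (Neg A)).
  { apply PImpI. apply PImpE with C; [hyp|].
    apply (prv_weaken p). intros B [<-|i]; cbn; auto. }
  apply PImpE with C; [hyp|]. apply (prv_cut n).
  apply (prv_weaken q). intros B [<-|i]; cbn; auto.
Qed.

Lemma eqp_sym G (H : list (fm G)) t (a b : tm G t) : eqp T H a b -> eqp T H b a.
Proof.
  intros e. generalize (PEqSubst (A := v0 ≡ wk_tm t a) e). simp_subst.
  intros h. apply h, PEqRefl.
Qed.

Lemma eqp_trans G (H : list (fm G)) t (a b c : tm G t) :
  eqp T H a b -> eqp T H b c -> eqp T H a c.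
Proof.
  intros e e'. generalize (PEqSubst (A := wk_tm t a ≡ v0) e'). simp_subst.
  intros h. exact (h e).
Qed.

Lemma eqp_app G (H : list (fm G)) s t (f g : tm G (s ⇒ t)) (a b : tm G s) :
  eqp T H f g -> eqp T H a b -> eqp T H (f ⋅ a) (g ⋅ b).
Proof.
  intros e e'. apply eqp_trans with (f ⋅ b).
  - generalize (PEqSubst (A := wk_tm s (f ⋅ a) ≡ wk_tm s f ⋅ v0) e'). simp_subst.
    intros h; apply h, PEqRefl.
  - generalize (PEqSubst (A := wk_tm (s ⇒ t) (f ⋅ b) ≡ v0 ⋅ wk_tm (s ⇒ t) b) e).
    simp_subst. intros h; apply h, PEqRefl.
Qed.

#[export] Instance eqp_equivalence G (H : list (fm G)) t : Equivalence (@eqp T G H t).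
Proof.
  split; red; [intros; apply PEqRefl|apply eqp_sym|apply eqp_trans].
Qed.

(** Rewriting can thus reach any position of a term that is not under a [Lam]; below binders,
    equality is obtained from [eqp_fun_ext]. *)
#[export] Instance eqp_app_Proper G (H : list (fm G)) s t :
  Proper (@eqp T G H _ ==> @eqp T G H _ ==> @eqp T G H _) (@App G s t).
Proof. intros f g e a b e'. now apply eqp_app. Qed.

Lemma eqp_beta G (H : list (fm G)) s t (b : tm (s :: G) t) (a : tm G s) :
  eqp T H (Lam s b ⋅ a) (sub_tm b (inst a)).
Proof. apply PBeta. Qed.

Context {ax : arithmetic T}.

Lemma prv_ax G (H : list (fm G)) A : EPAω A -> prv T H A.
Proof. intros i. apply PAx, ax, i. Qed.

Lemma eqp_rec_zero G (H : list (fm G)) t (z : tm G t) f : eqp T H (Rec ⋅ z ⋅ f ⋅ Zero) z.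
Proof. apply prv_ax, rec_zero. Qed.
Lemma eqp_rec_succ G (H : list (fm G)) t (z : tm G t) f a :
  eqp T H (Rec ⋅ z ⋅ f ⋅ Suc a) (f ⋅ a ⋅ (Rec ⋅ z ⋅ f ⋅ a)).
Proof. apply prv_ax, rec_succ. Qed.
Lemma eqp_seqrec_nil G (H : list (fm G)) Z t (z : tm G t) f :
  eqp T H (SeqRec ⋅ z ⋅ f ⋅ Cst (CNil Z)) z.
Proof. apply prv_ax, seqrec_nil. Qed.
Lemma eqp_seqrec_cons G (H : list (fm G)) Z t (z : tm G t) f a s :
  eqp T H (SeqRec ⋅ z ⋅ f ⋅ (Cst (CCons Z) ⋅ a ⋅ s)) (f ⋅ a ⋅ s ⋅ (SeqRec ⋅ z ⋅ f ⋅ s)).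
Proof. apply prv_ax, seqrec_cons. Qed.

Lemma prv_ind G (H : list (fm G)) (A : fm (N :: G)) :
  prv T H (sub_fm A (inst Zero)) ->
  prv T (A :: map (@wk_fm G N) H)
    (sub_fm A (scons (P := tm (N :: G)) (Suc v0) (fun _ v => Var (VS v)))) ->
  prv T H (∀[N] A).
Proof.
  intros p q. refine (PImpE (PImpE (prv_ax _ (induction _)) p) _).
  apply PAllI, PImpI, q.
Qed.

Lemma eqp_fun_ext G (H : list (fm G)) s t (f g : tm G (s ⇒ t)) :
  eqp T (map (@wk_fm G s) H) (wk_tm s f ⋅ v0) (wk_tm s g ⋅ v0) -> eqp T H f g.
Proof. intros p. refine (PImpE (prv_ax _ (fun_ext _ _)) _). now apply PAllI. Qed.

End Logic.

Ltac beta := repeat (rewrite eqp_beta; simp_subst).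

(** * Addition *)

Section Arithmetic.
Context {T : theory} {ax : arithmetic T}.

Lemma eqp_plus_zero G (H : list (fm G)) a : eqp T H (plus ⋅ a ⋅ Zero) a.
Proof. unfold plus. beta. apply eqp_rec_zero. Qed.

Lemma eqp_plus_succ G (H : list (fm G)) a b :
  eqp T H (plus ⋅ a ⋅ Suc b) (Suc (plus ⋅ a ⋅ b)).
Proof. unfold plus. beta. rewrite eqp_rec_succ. beta. reflexivity. Qed.

(** [plus] recurses on its second argument, so the equations governing the first one require
    induction. *)
Lemma eqp_zero_plus G (H : list (fm G)) b : eqp T H (plus ⋅ Zero ⋅ b) b.
Proof.
  assert (p : prv T H (∀[N] plus ⋅ Zero ⋅ v0 ≡ v0)).
  { apply prv_ind; simp_subst; [apply eqp_plus_zero|].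
    to_eqp.
    rewrite eqp_plus_succ. apply eqp_app; [reflexivity|hyp]. }
  generalize (PAllE b p). now simp_subst.
Qed.

Lemma eqp_succ_plus G (H : list (fm G)) a b :
  eqp T H (plus ⋅ Suc a ⋅ b) (Suc (plus ⋅ a ⋅ b)).
Proof.
  assert (p : prv T H (∀[N] plus ⋅ Suc (wk_tm N a) ⋅ v0 ≡ Suc (plus ⋅ wk_tm N a ⋅ v0))).
  { apply prv_ind; simp_subst.
    to_eqp.
    now rewrite !eqp_plus_zero.
    to_eqp.
    rewrite !eqp_plus_succ. apply eqp_app; [reflexivity|hyp]. }
  generalize (PAllE b p). now simp_subst.
Qed.

End Arithmetic.

(** * Order and finite sequences *)

(** The witness is the difference of the two numbers; persistence along a thread is proved by
    induction on it. *)
Definition Le G (a b : tm G N) : fm G := ∃[N] plus ⋅ wk_tm N a ⋅ v0 ≡ wk_tm N b.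

Lemma sub_Le G D (a b : tm G N) (r : sub G D) :
  sub_fm (Le a b) r = Le (sub_tm a r) (sub_tm b r).
Proof. unfold Le; cbn [sub_fm sub_tm]. now simp_subst. Qed.
Lemma ren_Le G D (a b : tm G N) (r : ren G D) :
  ren_fm (Le a b) r = Le (ren_tm a r) (ren_tm b r).
Proof. unfold Le; cbn [ren_fm ren_tm]. now simp_subst. Qed.
#[export] Hint Rewrite sub_Le ren_Le : subst.

Section Order.
Context {T : theory} {ax : arithmetic T}.

Lemma le_zero G (H : list (fm G)) a : prv T H (Le Zero a).
Proof. apply PExI with a; simp_subst. apply eqp_zero_plus. Qed.

Lemma le_succ G (H : list (fm G)) a b :
  prv T H (Le a b) -> prv T H (Le (Suc a) (Suc b)).
Proof.
  intros p. apply (PExE p). simp_subst. apply PExI with v0; simp_subst. to_eqp.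
  rewrite eqp_succ_plus. apply eqp_app; [reflexivity|hyp].
Qed.

Lemma lt_le G (H : list (fm G)) a b : prv T H (Lt a b) -> prv T H (Le (Suc a) b).
Proof.
  intros p. apply (PExE p). simp_subst. apply PExI with v0; simp_subst. to_eqp.
  rewrite eqp_succ_plus. hyp.
Qed.

End Order.

(** * Padded initial segments *)

Section Sequences.
Context {T : theory} {ax : arithmetic T}.

Lemma hat_seq_nil G (H : list (fm G)) Z i :
  eqp T H (hat_seq ⋅ Cst (CNil Z) ⋅ i) (zero G Z).
Proof.
  unfold hat_seq. beta. rewrite eqp_seqrec_nil. beta. reflexivity.
Qed.

Lemma hat_seq_cons_zero G (H : list (fm G)) Z (a : tm G Z) s :
  eqp T H (hat_seq ⋅ (Cst (CCons Z) ⋅ a ⋅ s) ⋅ Zero) a.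
Proof.
  unfold hat_seq. beta. rewrite eqp_seqrec_cons. beta. apply eqp_rec_zero.
Qed.

Lemma hat_seq_cons_succ G (H : list (fm G)) Z (a : tm G Z) s i :
  eqp T H (hat_seq ⋅ (Cst (CCons Z) ⋅ a ⋅ s) ⋅ Suc i) (hat_seq ⋅ s ⋅ i).
Proof.
  unfold hat_seq. beta. rewrite eqp_seqrec_cons. beta. rewrite eqp_rec_succ. beta.
  reflexivity.
Qed.

Lemma initseg_zero G (H : list (fm G)) Z (b : tm G (N ⇒ Z)) :
  eqp T H (initseg ⋅ b ⋅ Zero) (Cst (CNil Z)).
Proof. unfold initseg. beta. rewrite eqp_rec_zero. beta. reflexivity. Qed.

Lemma initseg_succ G (H : list (fm G)) Z (b : tm G (N ⇒ Z)) n :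
  eqp T H (initseg ⋅ b ⋅ Suc n)
    (Cst (CCons Z) ⋅ (b ⋅ Zero) ⋅ (initseg ⋅ Lam N (wk_tm N b ⋅ Suc v0) ⋅ n)).
Proof. unfold initseg. beta. rewrite eqp_rec_succ. beta. reflexivity. Qed.

Lemma hat_emp G (H : list (fm G)) X n : eqp T H (Hat (Cst (CEmp X)) ⋅ n) (zero G X).
Proof.
  refine (PImpE (prv_ax _ (hat_notin _ _)) _). apply prv_ax, dom_emp.
Qed.

(** By induction on the type: [dec] reads the one place where [enc] stores the code, namely a
    constant function at the canonical argument, the first component of a pair, the head of a
    singleton, or the value at 0. *)
Lemma dec_enc X : forall G (H : list (fm G)) n, eqp T H (dec G X ⋅ (enc G X ⋅ n)) n.
Proof.
  induction X; intros; cbn [dec enc]; beta.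
  - reflexivity.
  - apply IHX2.
  - rewrite (prv_ax _ (fst_pair _ _) : eqp T H _ _). apply IHX1.
  - rewrite hat_seq_cons_zero. apply IHX.
  - rewrite (PImpE (prv_ax _ (hat_ext_same _ _ _)) (prv_ax _ (dom_emp _ _)) : eqp T H _ _).
    apply IHX.
Qed.

Lemma hat_initseg_cases G (H : list (fm G)) Z (b : tm G (N ⇒ Z)) n i :
  prv T H ((Le (Suc i) n ⋀ hat_seq ⋅ (initseg ⋅ b ⋅ n) ⋅ i ≡ b ⋅ i) ⋁
           (Le n i ⋀ hat_seq ⋅ (initseg ⋅ b ⋅ n) ⋅ i ≡ zero G Z)).
Proof.
  (* The sequence is quantified inside the induction on the length, because the tail of an initial
     segment is an initial segment of the shifted sequence. *)
  assert (p : prv T H (∀[N] ∀[N ⇒ Z] ∀[N]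
    ((Le (Suc v0) v2 ⋀ hat_seq ⋅ (initseg ⋅ v1 ⋅ v2) ⋅ v0 ≡ v1 ⋅ v0) ⋁
     (Le v2 v0 ⋀ hat_seq ⋅ (initseg ⋅ v1 ⋅ v2) ⋅ v0 ≡ zero _ Z)))).
  { apply prv_ind; simp_subst.
    - apply PAllI, PAllI, POrIr, PAndI; [apply le_zero|].
      to_eqp. now rewrite initseg_zero, hat_seq_nil.
    (* The inner induction serves to split the position into zero and successor. *)
    - apply PAllI, prv_ind; simp_subst.
      + apply POrIl, PAndI; [apply le_succ, le_zero|].
        to_eqp. now rewrite initseg_succ, hat_seq_cons_zero.
      + match goal with |- prv _ (_ :: ?A :: ?L) _ =>
          assert (q : prv T (A :: L) A) by hyp end.
        apply prv_cons.
        (* The outer induction hypothesis, for the shifted sequence at the preceding position. *)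
        pose proof (PAllE v0 (PAllE (Lam N (v2 ⋅ Suc v0)) q)) as q'; clear q.
        simp_subst_in q'. apply (POrE q'); [apply POrIl|apply POrIr]; apply PAndI.
        * apply le_succ. eapply PAndEl; hyp.
        * to_eqp. rewrite initseg_succ, hat_seq_cons_succ; simp_subst.
          refine (eqp_trans (PAndEr (prv_head _ _)) (eqp_trans (eqp_beta _ _ _) _)).
          simp_subst. reflexivity.
        * apply le_succ. eapply PAndEl; hyp.
        * to_eqp. rewrite initseg_succ, hat_seq_cons_succ; simp_subst.
          exact (PAndEr (prv_head _ _)). }
  generalize (PAllE i (PAllE b (PAllE n p))). simp_subst. auto.
Qed.
End Sequences.

(** * Threads *)

Section Domains.
Context {T : theory} {ax : arithmetic T}.

Lemma in_dom_eqp G (H : list (fm G)) X (u v : tm G (X†)) m n :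
  eqp T H u v -> eqp T H m n -> prv T H (InDom u m) -> prv T H (InDom v n).
Proof.
  intros e e' p. to_eqp. rewrite <- e, <- e'. exact p.
Qed.

(** If [n] is in the domain of [u], the extension is [u] itself; otherwise [k], being in that
    domain, differs from [n] and is unaffected. *)
Lemma ext_extends G (H : list (fm G)) X (u : tm G (X†)) n x k :
  prv T H (InDom u k) ->
  prv T H (InDom (Ext u n x) k ⋀ Hat (Ext u n x) ⋅ k ≡ Hat u ⋅ k).
Proof.
  intros p. apply prv_cases with (InDom u n).
  - pose proof (PImpE (prv_ax _ (ext_in _ _ _)) (prv_head H (InDom u n)) : eqp T _ (Ext u n x) u)
      as e.
    apply PAndI; to_eqp; rewrite e; [exact (prv_cons _ p)|reflexivity].
  - assert (ne : prv T (Neg (InDom u n) :: H) (Neg (k ≡ n))).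
    { apply PImpI. apply prv_absurd with (InDom u n); [|hyp].
      apply (in_dom_eqp (u := u) (m := k)); [reflexivity|apply prv_head|].
      now apply prv_cons, prv_cons. }
    apply PAndI.
    + eapply eqp_trans; [exact (PImpE (prv_ax _ (dom_ext_other _ _ _ _)) ne)|].
      exact (prv_cons _ p).
    + exact (PImpE (prv_ax _ (hat_ext_other _ _ _ _)) ne).
Qed.

End Domains.

Notation Th φ α i := (thread ⋅ φ ⋅ α ⋅ i).

Definition enters G X (φ : tm G ((N ⇒ X) ⇒ N)) (α : tm G (N ⇒ X)) (k j : tm G N) : fm G :=
  InDom (Th φ α (Suc j)) k ⋀ Neg (InDom (Th φ α j) k).

(** The second disjunct leaves [j] unconstrained, so that every [k] has some [j] and choice gives a
    total function. *)
Definition entry G X (φ : tm G ((N ⇒ X) ⇒ N)) (α : tm G (N ⇒ X)) (k j : tm G N) : fm G :=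
  enters φ α k j ⋁
  ∀[N] Neg (InDom (Th (wk_tm N φ) (wk_tm N α) v0) (wk_tm N k)).

Lemma sub_enters G D X φ (α : tm G (N ⇒ X)) k j (r : sub G D) :
  sub_fm (enters φ α k j) r = enters (sub_tm φ r) (sub_tm α r) (sub_tm k r) (sub_tm j r).
Proof. reflexivity. Qed.
Lemma ren_enters G D X φ (α : tm G (N ⇒ X)) k j (r : ren G D) :
  ren_fm (enters φ α k j) r = enters (ren_tm φ r) (ren_tm α r) (ren_tm k r) (ren_tm j r).
Proof. reflexivity. Qed.
#[export] Hint Rewrite sub_enters ren_enters : subst.
Lemma sub_entry G D X φ (α : tm G (N ⇒ X)) k j (r : sub G D) :
  sub_fm (entry φ α k j) r = entry (sub_tm φ r) (sub_tm α r) (sub_tm k r) (sub_tm j r).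
Proof. unfold entry. now simp_subst. Qed.
Lemma ren_entry G D X φ (α : tm G (N ⇒ X)) k j (r : ren G D) :
  ren_fm (entry φ α k j) r = entry (ren_tm φ r) (ren_tm α r) (ren_tm k r) (ren_tm j r).
Proof. unfold entry. now simp_subst. Qed.
#[export] Hint Rewrite sub_entry ren_entry : subst.

Section Threads.
Context {T : theory} {ax : arithmetic T} {X : ty}.

Lemma thread_zero G (H : list (fm G)) φ (α : tm G (N ⇒ X)) : eqp T H (Th φ α Zero) Emp.
Proof. unfold thread. beta. apply eqp_rec_zero. Qed.

Lemma phihat_app G (H : list (fm G)) (φ : tm G ((N ⇒ X) ⇒ N)) u :
  eqp T H (phihat ⋅ φ ⋅ u) (φ ⋅ Hat u).
Proof. unfold phihat. beta. reflexivity. Qed.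

Lemma thread_succ G (H : list (fm G)) φ (α : tm G (N ⇒ X)) i :
  eqp T H (Th φ α (Suc i))
    (Ext (Th φ α i) (φ ⋅ Hat (Th φ α i)) (α ⋅ (φ ⋅ Hat (Th φ α i)))).
Proof.
  rewrite <- phihat_app. unfold thread. beta. rewrite eqp_rec_succ. beta. reflexivity.
Qed.

Lemma thread_step G (H : list (fm G)) φ (α : tm G (N ⇒ X)) i k :
  prv T H (InDom (Th φ α i) k) ->
  prv T H (InDom (Th φ α (Suc i)) k ⋀ Hat (Th φ α (Suc i)) ⋅ k ≡ Hat (Th φ α i) ⋅ k).
Proof.
  intros p.
  pose proof (ext_extends (φ ⋅ Hat (Th φ α i)) (α ⋅ (φ ⋅ Hat (Th φ α i))) p) as q.
  apply PAndI; to_eqp; rewrite thread_succ; [exact (PAndEl q)|exact (PAndEr q)].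
Qed.

Lemma thread_plus G (H : list (fm G)) φ (α : tm G (N ⇒ X)) i j k m :
  eqp T H (plus ⋅ i ⋅ m) j -> prv T H (InDom (Th φ α i) k) ->
  prv T H (InDom (Th φ α j) k ⋀ Hat (Th φ α j) ⋅ k ≡ Hat (Th φ α i) ⋅ k).
Proof.
  intros e h.
  assert (p : prv T H (∀[N]
    (InDom (Th (wk_tm N φ) (wk_tm N α) (plus ⋅ wk_tm N i ⋅ v0)) (wk_tm N k) ⋀
     Hat (Th (wk_tm N φ) (wk_tm N α) (plus ⋅ wk_tm N i ⋅ v0)) ⋅ wk_tm N k ≡
     Hat (Th (wk_tm N φ) (wk_tm N α) (wk_tm N i)) ⋅ wk_tm N k))).
  { apply prv_ind; simp_subst.
    - apply PAndI; to_eqp; rewrite eqp_plus_zero; [exact h|reflexivity].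
    - match goal with |- prv _ (?A :: ?L) _ =>
        pose proof (thread_step (PAndEl (prv_head L A))) as q end.
      apply PAndI; to_eqp; rewrite eqp_plus_succ; [exact (PAndEl q)|].
      exact (eqp_trans (PAndEr q) (PAndEr (prv_head _ _))). }
  pose proof (PAllE m p) as q. simp_subst_in q.
  apply PAndI; to_eqp; rewrite <- e; [exact (PAndEl q)|exact (PAndEr q)].
Qed.

Lemma thread_le G (H : list (fm G)) φ (α : tm G (N ⇒ X)) i j k :
  prv T H (Le i j) -> prv T H (InDom (Th φ α i) k) ->
  prv T H (InDom (Th φ α j) k ⋀ Hat (Th φ α j) ⋅ k ≡ Hat (Th φ α i) ⋅ k).
Proof.
  (* Membership is turned into an object-level hypothesis, so that [PExE] weakens it along with the
     others. *)
  intros l h. refine (PImpE _ h). apply PImpI.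
  apply (PExE (prv_cons _ l)). simp_subst.
  apply thread_plus with v0; hyp.
Qed.

(** Induction on [i]: stage 0 has empty domain, and at a successor either [k] was present one stage
    earlier or that earlier stage is where it enters. *)
Lemma in_thread_enters G (H : list (fm G)) φ (α : tm G (N ⇒ X)) i k :
  prv T H (InDom (Th φ α i) k ⊃ ∃[N] enters (wk_tm N φ) (wk_tm N α) (wk_tm N k) v0).
Proof.
  assert (p : prv T H (∀[N]
    (InDom (Th (wk_tm N φ) (wk_tm N α) v0) (wk_tm N k) ⊃
     ∃[N] enters (wk_tm N (wk_tm N φ)) (wk_tm N (wk_tm N α)) (wk_tm N (wk_tm N k)) v0))).
  { apply prv_ind; simp_subst.
    - apply PImpI. apply prv_absurd with (InDom (Cst (CEmp X)) k).
      + apply (in_dom_eqp (u := Th φ α Zero) (m := k));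
          [apply thread_zero|reflexivity|apply prv_head].
      + apply prv_ax, dom_emp.
    - apply PImpI, prv_cases with (InDom (Th (wk_tm N φ) (wk_tm N α) v0) (wk_tm N k)).
      + eapply PImpE; hyp.
      + apply PExI with v0; simp_subst. apply PAndI; hyp. }
  generalize (PAllE i p). simp_subst. auto.
Qed.

Lemma enters_eqp G (H : list (fm G)) φ (α : tm G (N ⇒ X)) k i j :
  eqp T H i j -> prv T H (enters φ α k i) -> prv T H (enters φ α k j).
Proof.
  intros e. generalize (PEqSubst (A := enters (wk_tm N φ) (wk_tm N α) (wk_tm N k) v0) e).
  simp_subst. auto.
Qed.

(** The stage is given as the decoding of an object of type [X], the form to which choice into [X]
    applies. *)
Lemma entry_exists G (H : list (fm G)) φ (α : tm G (N ⇒ X)) k :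
  prv T H (∃[X] entry (wk_tm X φ) (wk_tm X α) (wk_tm X k) (dec _ X ⋅ v0)).
Proof.
  apply prv_cases with (∃[N] enters (wk_tm N φ) (wk_tm N α) (wk_tm N k) v0).
  - apply (PExE (prv_head _ _)). simp_subst.
    (* The code of the stage at which [k] enters. *)
    apply PExI with (enc _ X ⋅ v0). simp_subst. apply POrIl.
    apply enters_eqp with v0; [symmetry; apply dec_enc|apply prv_head].
  (* If [k] never enters, any object will do. *)
  - apply PExI with (zero _ X). simp_subst. apply POrIr, PAllI, PImpI. simp_subst.
    eapply prv_absurd; [|apply prv_cons, prv_head].
    exact (PImpE (in_thread_enters _ _ _ _ _) (prv_head _ _)).
Qed.

End Threads.

(** * The application of Spec *)

(** The sequence and, as [stage], the functional to which [Spec] is applied. *)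
Definition shift G X (φ : tm G ((N ⇒ X) ⇒ N)) (α : tm G (N ⇒ X)) : tm G (N ⇒ X†) :=
  Lam N (Th (wk_tm N φ) (wk_tm N α) (Suc v0)).

Definition glued G X (h : tm G (N ⇒ N)) (γ : tm G (N ⇒ X†)) : tm G (N ⇒ X) :=
  Lam N (Hat (wk_tm N γ ⋅ (wk_tm N h ⋅ v0)) ⋅ v0).

Definition stage G X (φ : tm G ((N ⇒ X) ⇒ N)) (h : tm G (N ⇒ N)) : tm G ((N ⇒ X†) ⇒ N) :=
  Lam (N ⇒ X†) (wk_tm _ h ⋅ (wk_tm _ φ ⋅ glued (wk_tm _ h) v0)).

Lemma sub_shift G D X φ (α : tm G (N ⇒ X)) (r : sub G D) :
  sub_tm (shift φ α) r = shift (sub_tm φ r) (sub_tm α r).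
Proof. unfold shift. now simp_subst. Qed.
Lemma ren_shift G D X φ (α : tm G (N ⇒ X)) (r : ren G D) :
  ren_tm (shift φ α) r = shift (ren_tm φ r) (ren_tm α r).
Proof. unfold shift. now simp_subst. Qed.
Lemma sub_glued G D X h (γ : tm G (N ⇒ X†)) (r : sub G D) :
  sub_tm (glued h γ) r = glued (sub_tm h r) (sub_tm γ r).
Proof. unfold glued. now simp_subst. Qed.
Lemma ren_glued G D X h (γ : tm G (N ⇒ X†)) (r : ren G D) :
  ren_tm (glued h γ) r = glued (ren_tm h r) (ren_tm γ r).
Proof. unfold glued. now simp_subst. Qed.
#[export] Hint Rewrite sub_shift ren_shift sub_glued ren_glued : subst.
Lemma sub_stage G D X (φ : tm G ((N ⇒ X) ⇒ N)) h (r : sub G D) :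
  sub_tm (stage φ h) r = stage (sub_tm φ r) (sub_tm h r).
Proof. unfold stage. now simp_subst. Qed.
Lemma ren_stage G D X (φ : tm G ((N ⇒ X) ⇒ N)) h (r : ren G D) :
  ren_tm (stage φ h) r = stage (ren_tm φ r) (ren_tm h r).
Proof. unfold stage. now simp_subst. Qed.
#[export] Hint Rewrite sub_stage ren_stage : subst.

Section Spector.
Context {T : theory} {ax : arithmetic T} {X : ty}.

Lemma shift_app G (H : list (fm G)) φ (α : tm G (N ⇒ X)) i :
  eqp T H (shift φ α ⋅ i) (Th φ α (Suc i)).
Proof. unfold shift. beta. reflexivity. Qed.

Lemma eqp_hat_notin G (H : list (fm G)) (u : tm G (X†)) k :
  prv T H (Neg (InDom u k)) -> eqp T H (Hat u ⋅ k) (zero G X).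
Proof. exact (PImpE (prv_ax _ (hat_notin _ _))). Qed.

(** For [j < n] the left side reads stage [j + 1], which contains [k] and is extended by stage [n].
    For [n ≤ j] both sides are the canonical element, since [k] is still absent at stage [j] and
    hence at stage [n]. *)
Lemma hat_initseg_shift_enters G (H : list (fm G)) φ (α : tm G (N ⇒ X)) k j n :
  prv T H (enters φ α k j) ->
  eqp T H (Hat (hat_seq ⋅ (initseg ⋅ shift φ α ⋅ n) ⋅ j) ⋅ k) (Hat (Th φ α n) ⋅ k).
Proof.
  intros p. apply (POrE (hat_initseg_cases _ (shift φ α) n j)).
  all: match goal with |- prv _ (?A :: ?L) _ =>
         pose proof (PAndEl (prv_head (T := T) L A)) as l;
         pose proof (PAndEr (prv_head (T := T) L A) : eqp _ _ _ _) as e;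
         pose proof (prv_cons A p) as p';
         revert l e p'; generalize (A :: L); intros L' l e p'
       end; to_eqp; rewrite e.
  - rewrite shift_app. symmetry. exact (PAndEr (thread_le l (PAndEl p'))).
  (* The padding value at type [X†] is the nowhere-defined function. *)
  - cbn [zero]. rewrite hat_emp. symmetry. apply eqp_hat_notin, PImpI.
    refine (prv_absurd _ _ (prv_cons _ (PAndEr p'))).
    exact (PAndEl (thread_le (prv_cons _ l) (prv_head _ _))).
Qed.

(** The left side reads either a stage of the thread or the empty padding; both are undefined at
    [k], as is stage [n]. *)
Lemma hat_initseg_shift_never G (H : list (fm G)) φ (α : tm G (N ⇒ X)) k j n :
  (forall i, prv T H (Neg (InDom (Th φ α i) k))) ->
  eqp T H (Hat (hat_seq ⋅ (initseg ⋅ shift φ α ⋅ n) ⋅ j) ⋅ k) (Hat (Th φ α n) ⋅ k).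
Proof.
  intros p. rewrite (eqp_hat_notin (p n)).
  apply (POrE (hat_initseg_cases _ (shift φ α) n j)).
  all: match goal with |- prv _ (?A :: ?L) _ =>
         pose proof (PAndEr (prv_head (T := T) L A) : eqp _ _ _ _) as e;
         pose proof (fun i => prv_cons A (p i)) as p';
         revert e p'; generalize (A :: L); intros L' e p'
       end; to_eqp; rewrite e.
  - rewrite shift_app. apply eqp_hat_notin, p'.
  - apply hat_emp.
Qed.

Lemma hat_initseg_shift G (H : list (fm G)) φ (α : tm G (N ⇒ X)) k j n :
  prv T H (entry φ α k j) ->
  eqp T H (Hat (hat_seq ⋅ (initseg ⋅ shift φ α ⋅ n) ⋅ j) ⋅ k) (Hat (Th φ α n) ⋅ k).
Proof.
  intros p. apply (POrE p).
  - apply hat_initseg_shift_enters, prv_head.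
  - apply hat_initseg_shift_never. intros i.
    match goal with |- prv _ (?A :: ?L) _ => generalize (PAllE i (prv_head (T := T) L A)) end.
    simp_subst. auto.
Qed.

(** Extensionality turns the pointwise agreement into an equality of functions, under which [φ]
    takes the same value on both sides. *)
Lemma glued_initseg_shift G (H : list (fm G)) φ (α : tm G (N ⇒ X)) h n :
  prv T H (∀[N] entry (wk_tm N φ) (wk_tm N α) v0 (wk_tm N h ⋅ v0)) ->
  eqp T H (glued h (hat_seq ⋅ (initseg ⋅ shift φ α ⋅ n))) (Hat (Th φ α n)).
Proof.
  (* The cut places [p] among the hypotheses, so that it is weakened with them to the context
     containing the new argument. *)
  intros p. apply (prv_cut p), eqp_fun_ext. simp_subst.
  eapply eqp_trans; [apply eqp_beta|]. simp_subst.
  apply hat_initseg_shift.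
  match goal with |- prv _ (?A :: ?L) _ => generalize (PAllE v0 (prv_head (T := T) L A)) end.
  simp_subst. auto.
Qed.

Lemma le_eqp G (H : list (fm G)) a a' b :
  eqp T H a a' -> prv T H (Le a b) -> prv T H (Le a' b).
Proof. intros e. generalize (PEqSubst (A := Le v0 (wk_tm N b)) e). simp_subst. auto. Qed.

Lemma spec_in_dom G (H : list (fm G)) φ (α : tm G (N ⇒ X)) h n :
  prv T H (∀[N] entry (wk_tm N φ) (wk_tm N α) v0 (wk_tm N h ⋅ v0)) ->
  prv T H (Lt (stage φ h ⋅ (hat_seq ⋅ (initseg ⋅ shift φ α ⋅ n))) n) ->
  prv T H (InDom (Th φ α n) (φ ⋅ Hat (Th φ α n))).
Proof.
  intros p l. set (k := φ ⋅ Hat (Th φ α n)).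
  assert (e : eqp T H (Suc (stage φ h ⋅ (hat_seq ⋅ (initseg ⋅ shift φ α ⋅ n)))) (Suc (h ⋅ k))).
  { apply eqp_app; [reflexivity|]. eapply eqp_trans; [apply eqp_beta|]. simp_subst.
    subst k. do 2 (apply eqp_app; [reflexivity|]). now apply glued_initseg_shift. }
  (* The inequality now says that stage [h k + 1], the first to contain [k] if [k] enters, is no
     later than stage [n]. *)
  pose proof (le_eqp e (lt_le l)) as l'.
  pose proof (PAllE k p) as q. simp_subst_in q.
  apply (POrE q).
  - exact (PAndEl (thread_le (prv_cons _ l') (PAndEl (prv_head _ _)))).
  (* The step from stage [n] to [n + 1] ensures that [k] is in the domain, so [k] cannot be absent
     from every stage. *)
  - match goal with |- prv _ (?A :: ?L) _ =>
      pose proof (PAllE (Suc n) (prv_head (T := T) L A)) as q' end.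
    simp_subst_in q'. refine (prv_absurd _ _ q').
    apply in_dom_eqp with (Ext (Th φ α n) k (α ⋅ k)) k; [|reflexivity|apply prv_ax, dom_ext_same].
    symmetry. apply thread_succ.
Qed.

Lemma entry_eqp G (H : list (fm G)) φ (α : tm G (N ⇒ X)) k i j :
  eqp T H i j -> prv T H (entry φ α k i) -> prv T H (entry φ α k j).
Proof.
  intros e. generalize (PEqSubst (A := entry (wk_tm N φ) (wk_tm N α) (wk_tm N k) v0) e).
  simp_subst. auto.
Qed.

Lemma entry_function G (H : list (fm G)) φ (α : tm G (N ⇒ X)) :
  (forall G (A : fm G), AC_N X A -> T A) ->
  prv T H (∃[N ⇒ N] ∀[N] entry (wk_tm N (wk_tm _ φ)) (wk_tm N (wk_tm _ α)) v0 (v1 ⋅ v0)).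
Proof.
  intros ac.
  pose proof (PAx H (ac _ _ (choice
    (entry (wk_tm X (wk_tm N φ)) (wk_tm X (wk_tm N α)) v1 (dec (X :: N :: G) X ⋅ v0))))) as c.
  simp_subst_in c.
  refine (PExE (PImpE c _) _).
  - apply PAllI. exact (entry_exists _ (wk_tm N φ) (wk_tm N α) v0).
  (* The function chosen into [X], followed by the decoding. *)
  - simp_subst. apply PExI with (Lam N (dec _ X ⋅ (v1 ⋅ v0))). simp_subst.
    apply PAllI. simp_subst.
    match goal with |- prv _ (?A :: ?L) _ => pose proof (PAllE v0 (prv_head (T := T) L A)) as q end.
    simp_subst_in q.
    refine (entry_eqp _ q).
    symmetry. eapply eqp_trans; [apply eqp_beta|]. simp_subst. reflexivity.
Qed.

End Spector.

Theorem theorem2p10 : forall X : ty,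
  provable (EPAω ∪ AC_N X ∪ SpecAx (X†)) (sSpec nil X).
Proof.
  intros X. set (T := EPAω ∪ AC_N X ∪ SpecAx (X†)).
  assert (ax : arithmetic T) by (intros G A i; now left; left).
  apply PAllI, PAllI. simp_subst.
  refine (PExE (entry_function _ v1 v0 _) _); [intros G A i; now left; right|].
  simp_subst.
  (* In this context [v2], [v1] and [v0] are φ, α and the entry function [h]. *)
  assert (s : prv T [∀[N] entry v3 v2 v0 (v1 ⋅ v0)] (Spec [N ⇒ N; N ⇒ X; (N ⇒ X) ⇒ N] (X†)))
    by (apply PAx; right; constructor).
  pose proof (PAllE (shift v2 v1) (PAllE (stage v2 v0) s)) as q. simp_subst_in q.
  apply (PExE q). simp_subst.
  (* The index supplied by [Spec] is itself the required stage; binding it moves φ, α and [h] to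
     [v3], [v2] and [v1]. *)
  apply PExI with v0. simp_subst.
  refine (in_dom_eqp (reflexivity _) _ (spec_in_dom (φ := v3) (α := v2) (h := v1) (n := v0) _ _)).
  - symmetry. apply phihat_app.
  - hyp.
  - hyp.
Qed.
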